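(* Let $\mathbb{H}$ be a real Hilbert space, let $E$ be a subset of $\mathbb{H}$ and let $f:E\to\mathbb{R}$, $G:E\to\mathbb{H}$ be two functions. Then there exists a convex function $F:\mathbb{H}\to\mathbb{R}$ of class $C^{1,1}(\mathbb{H})$ such that $F=f$ and $\nabla F=G$ on $E$ if and only if $(f,G)$ satisfies condition $(CW^{1,1})$ on $E$, that is, there exists a constant $M>0$ such that $$f(x)-f(y)-\langle G(y),x-y\rangle\ \ge\ \frac{1}{2M}\|G(x)-G(y)\|^2\qquad\text{for all }x,y\in E.$$ Moreover, if $M>0$ is a constant for which this inequality holds for all $x,y\in E$, then $F$ can be taken such that $(F,\nabla F)$ satisfies $(CW^{1,1})$ on $\mathbb{H}$ with the same constant $M$, i.e. $$F(x)-F(y)-\langle \nabla F(y),x-y\rangle\ \ge\ \frac{1}{2M}\|\nabla F(x)-\nabla F(y)\|^2\qquad\text{for all }x,y\in \mathbb{H}.$$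
   Context: $\mathbb{H}$ is a real Hilbert space (of arbitrary dimension) with inner product $\langle\cdot,\cdot\rangle$ and norm $\|\cdot\|$. A function $F:\mathbb{H}\to\mathbb{R}$ is of class $C^{1,1}(\mathbb{H})$ if it is (Fréchet) differentiable on $\mathbb{H}$ and its gradient $\nabla F:\mathbb{H}\to\mathbb{H}$ is (globally) Lipschitz. *)

(* Defs.v *)
From HB Require Import structures.
From mathcomp Require Import all_boot all_order all_algebra.
From mathcomp Require Import all_classical all_reals all_analysis.

Set Implicit Arguments.
Unset Strict Implicit.
Unset Printing Implicit Defensive.

Import Order.TTheory GRing.Theory Num.Theory.
Import numFieldNormedType.Exports.

Local Open Scope classical_set_scope.
Local Open Scope ring_scope.

(* A real Hilbert space is a complete normed space H whose norm is induced by
   a positive definite symmetric bilinear form. *)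
Definition norm_induced_by (R : realType) (H : normedModType R)
    (dot : {dot H for idfun}) : Prop :=
  forall x : H, `|x| ^+ 2 = dot x x.

(* The Riesz representative of the Frechet differential. [get] returns an
   arbitrary vector where there is no representative, but the Riesz theorem
   excludes this at every point of differentiability when H is complete and
   [norm_induced_by dot] holds. *)
Definition gradient (R : realType) (H : normedModType R)
    (dot : {dot H for idfun}) (F : H -> R^o) (x : H) : H :=
  get [set v : H | forall h : H, 'd F x h = dot v h].

Definition C11 (R : realType) (H : normedModType R)
    (dot : {dot H for idfun}) (F : H -> R^o) : Prop :=
  (forall x : H, differentiable F x) /\ lipschitz (gradient dot F).

(* Only the values of f and G on E matter. *)
Definition CW11 (R : realType) (H : normedModType R)
    (dot : {dot H for idfun}) (M : R) (E : set H)
    (f : H -> R) (G : H -> H) : Prop :=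
  forall x y : H, E x -> E y ->
    f x - f y - dot (G y) (x - y) >= (2 * M)^-1 * `|G x - G y| ^+ 2.

(* Main.v *)
Require Import Defs.
From HB Require Import structures.
From mathcomp Require Import all_boot all_order all_algebra.
From mathcomp Require Import all_classical all_reals all_analysis.
From mathcomp Require Import ring lra.

Set Implicit Arguments.
Unset Strict Implicit.
Unset Printing Implicit Defensive.

Import Order.TTheory GRing.Theory Num.Theory.
Import numFieldNormedType.Exports.

Local Open Scope classical_set_scope.
Local Open Scope ring_scope.

(** The sufficiency of the condition rests on a change of variables.  Sending
    x in E to z(x) = x - G(x)/M, with the value f(x) - |G(x)|^2/(2M) and the
    slope G(x) kept, turns the condition (CW^{1,1}) into

      value(z(x)) >= value(z(y)) + <G(y), z(x) - z(y)>,

    that is, M disappears and the slopes G(y) are subgradients of the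
    transported values.  Such data are interpolated by the supremum phi of their
    supporting affine functions, a convex function with values in ]-oo, +oo].
    The change of variables is undone by the Moreau envelope

      F(x) = inf_z phi(z) + M/2 |x - z|^2.

    F is convex, as a partial infimum of a jointly convex function, and
    F - M/2 |.|^2 is an infimum of affine functions, so F lies below a
    paraboloid of curvature M touching it at each point.  Together with
    convexity this pins F between its tangent plane and that paraboloid
    ([convex_above_supergradient]), which gives differentiability, the Lipschitz
    bound and the condition (CW^{1,1}) with the constant M on the whole space
    ([convex_C11_of_tangent_paraboloids]).  At a point of E the candidate
    z(x) bounds F from above and the affine function with slope G(x) bounds it
    from below, both with value f(x) and slope G(x).

    Completeness enters through [supergradient_of_approximations] alone:
    supergradients of a midpoint convex function up to an error e form a set of
    diameter O(sqrt e), hence converge to an exact one.  It yields the gradient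
    of the Moreau envelope (near minimizers z give M(x - z)) and also the Riesz
    representation theorem (near maximizers of L - |.|^2/2 nearly represent L),
    without which [gradient] could not be related to the differential.

    Conversely, if F is convex with a K-Lipschitz gradient, the tangent plane
    at x + h gives F(x) >= F(x + h) - <grad F(x + h), h>, so
    F(x + h) <= F(x) + <grad F(x), h> + K |h|^2: the previous situation with
    M = 2K, and the condition restricts from the whole space to E. *)

(** * Comparing first-order and second-order terms *)

(** Divide by t and let t tend to 0.  Applied along rays t h, this discards a
    second-order error from a first-order inequality. *)
Lemma le0_of_le_quadratic (R : realFieldType) (a b : R) :
  (forall t, 0 < t <= 1 -> t * a <= t ^+ 2 * b) -> a <= 0.
Proof.
move=> ab; rewrite leNgt; apply/negP => a_gt0.
have b_gt0 : 0 < b.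
  have := ab 1; rewrite ltr01 lexx expr1n !mul1r => /(_ isT).
  exact: lt_le_trans.
(* The choice makes t * b < a while keeping t <= 1. *)
pose t := a / (a + b) / 2.
have ab0 : a + b != 0 by rewrite gt_eqF// addr_gt0.
have t_gt0 : 0 < t by rewrite !divr_gt0// addr_gt0.
have tE : t * (a + b) * 2 = a by rewrite /t; field.
have t_le1 : t <= 1 by nra.
have := ab t; rewrite t_gt0 t_le1 => /(_ isT).
rewrite expr2 -mulrA ler_pM2l//; nra.
Qed.

(** * Inner products and gradients *)

Section InnerProduct.
Context (R : realType) (H : normedModType R) (dot : {dot H for idfun}).
Implicit Types u v w : H.

Lemma dotC u v : dot u v = dot v u.
Proof. by rewrite (hermC dot u v) expr0 mul1r. Qed.

Lemma dotDl u v w : dot (u + v) w = dot u w + dot v w.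
Proof. exact: linearDl. Qed.

Lemma dotNl u v : dot (- u) v = - dot u v.
Proof. exact: linearNl. Qed.

Lemma dotZl a u v : dot (a *: u) v = a * dot u v.
Proof. exact: linearZl. Qed.

Lemma dotDr u v w : dot u (v + w) = dot u v + dot u w.
Proof. by rewrite dotC dotDl !(dotC u). Qed.

Lemma dotNr u v : dot u (- v) = - dot u v.
Proof. by rewrite dotC dotNl (dotC u). Qed.

Lemma dotZr a u v : dot u (a *: v) = a * dot u v.
Proof. by rewrite dotC dotZl (dotC u). Qed.

Definition dotE := (dotDl, dotDr, dotNl, dotNr, dotZl, dotZr).

Hypothesis Hdot : norm_induced_by dot.

(** Cauchy-Schwarz: the squared norm of |v|^2 u - <u,v> v is nonnegative. *)
Lemma normr_dot_le u v : `|dot u v| <= `|u| * `|v|.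
Proof.
rewrite -ler_sqr ?nnegrE ?mulr_ge0// real_normK ?num_real// exprMn !Hdot.
have [->|v0] := eqVneq v 0.
  by rewrite -(scale0r (0 : H)) !dotZr !mul0r mulr0 expr0n.
have vv : 0 < dot v v by rewrite -Hdot exprn_gt0// normr_gt0.
have : 0 <= dot (dot v v *: u - dot u v *: v) (dot v v *: u - dot u v *: v).
  by rewrite -Hdot sqr_ge0.
rewrite !dotE (dotC v u); nra.
Qed.

(** The codomain R^o makes the pairing with u a linear map between normed
    modules, as differentials are. *)
Definition dot_functional u : H -> R^o := dot u.

Lemma dot_functional_linear u : linear (dot_functional u).
Proof. by move=> a v w; rewrite /dot_functional !dotE. Qed.
HB.instance Definition _ u :=
  GRing.isLinear.Build R H R^o *:%R (dot_functional u) (dot_functional_linear u).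

Lemma differentiable_of_quadratic_remainder (F : H -> R^o) (x u : H) (C : R) :
  (forall h, `|F (x + h) - F x - dot u h| <= C * `|h| ^+ 2) ->
  differentiable F x /\ 'd F x = dot u :> (H -> R).
Proof.
move=> FC.
have ctnf : continuous (dot_functional u).
  apply/linear_bounded_continuous/linear_boundedP.
  near=> r => v.
  apply: le_trans (normr_dot_le u v) _.
  by rewrite ler_wpM2r//; near: r; apply: nbhs_pinfty_ge; rewrite num_real.
have Fo : F \o shift x = cst (F x) + dot_functional u +o_ 0 id.
  apply/eqaddoP => e e0.
  have eC : 0 < e / (`|C| + 1) by rewrite divr_gt0// ltr_wpDl.
  near=> h.
  rewrite -[_ h]/(F (h + x) - (F x + dot u h)) opprD addrA (addrC h).
  apply: le_trans (FC h) _; rewrite expr2 mulrA ler_wpM2r//.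
  apply: (@le_trans _ _ ((`|C| + 1) * `|h|)).
    by rewrite ler_wpM2r// ler_wpDr// ler_norm.
  by rewrite mulrC -ler_pdivlMr ?ltr_wpDl//.
have dF : 'd F x = dot_functional u :> (H -> R^o) by apply: diff_unique.
by split=> //; apply/diff_locallyP; rewrite dF.
Unshelve. all: by end_near. Qed.

(** At most one vector represents a linear functional, so the choice made in
    [gradient] is forced as soon as a representative is known. *)
Lemma gradientE (F : H -> R^o) (x g : H) :
  (forall h, 'd F x h = dot g h) -> gradient dot F x = g.
Proof.
move=> Fg.
have /(_ (gradient dot F x - g)) : forall h, 'd F x h = dot (gradient dot F x) h.
  by apply: (@getPex _ [set v | forall h, 'd F x h = dot v h]); exists g.
move=> /eqP; rewrite Fg -subr_eq0 -opprB oppr_eq0 -dotNl -dotDl -Hdot.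
by rewrite expf_eq0/= normr_eq0 subr_eq0 => /eqP.
Qed.

End InnerProduct.

(** * Completeness: exact supergradients and the Riesz theorem *)

Section Completeness.
Context (R : realType) (H : completeNormedModType R) (dot : {dot H for idfun}).
Implicit Types u v w : H.
Hypothesis Hdot : norm_induced_by dot.

(** If g and g' satisfy the bound with errors e and e', adding the bound for g
    at -h to the one for g' at h and using phi(h) + phi(-h) >= 0 gives
    <g - g', h> <= e + e' + M |h|^2 for every h, whence
    |g - g'|^2 <= 4M (e + e').  Approximate supergradients with vanishing errors
    therefore form a Cauchy sequence, and its limit has no error left. *)
Lemma supergradient_of_approximations (phi : H -> R) (M : R) : 0 < M ->
  (forall h, 0 <= phi h + phi (- h)) ->
  (forall e, 0 < e ->
    exists g, forall h, phi h <= e + dot g h + M / 2 * `|h| ^+ 2) ->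
  exists g, forall h, phi h <= dot g h + M / 2 * `|h| ^+ 2.
Proof.
move=> M0 phi_mid phi_approx.
have /choice[g gP] : forall n, exists g,
    forall h, phi h <= harmonic n + dot g h + M / 2 * `|h| ^+ 2.
  by move=> n; apply: phi_approx; exact: harmonic_gt0.
have close n m : `|g n - g m| ^+ 2 <= 4 * M * (harmonic n + harmonic m).
  (* The minimizer of M |h|^2 - <d, h>. *)
  pose d := g n - g m; pose h := (2 * M)^-1 *: d.
  have hh : `|h| ^+ 2 = (2 * M)^-1 ^+ 2 * `|d| ^+ 2.
    by rewrite normrZ exprMn real_normK ?num_real.
  have dh : dot (g n) h - dot (g m) h = (2 * M)^-1 * `|d| ^+ 2.
    by rewrite -dotNl -dotDl dotZr -Hdot.
  have := phi_mid (- h); rewrite opprK => /le_trans/(_ (lerD (gP n _) (gP m _))).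
  rewrite normrN dotNr => ineq.
  have {}ineq : 0 <= harmonic n + harmonic m - (dot (g n) h - dot (g m) h) +
      M * `|h| ^+ 2 by lra.
  move: ineq; rewrite hh dh; set D := `|d| ^+ 2; set e := harmonic n + _.
  have -> : e - (2 * M)^-1 * D + M * ((2 * M)^-1 ^+ 2 * D) = e - D / (4 * M).
    by field; rewrite gt_eqF.
  by rewrite subr_ge0 ler_pdivrMr ?mulr_gt0// mulrC.
have /cvg_ex[l gl] : cvgn g.
  apply/cauchy_cvgP/cauchy_ballP => e e0.
  have e1 : 0 < e ^+ 2 / (8 * M) by rewrite divr_gt0 ?exprn_gt0 ?mulr_gt0.
  rewrite near_map2; near=> n m.
  rewrite /= -ball_normE /= -ltr_sqr ?nnegrE ?(ltW e0)//.
  apply: le_lt_trans (close _ _) _.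
  have p1 : harmonic n < e ^+ 2 / (8 * M).
    by near: n; exact: (near_infty_natSinv_lt (PosNum e1)).
  have p2 : harmonic m < e ^+ 2 / (8 * M).
    by near: m; exact: (near_infty_natSinv_lt (PosNum e1)).
  rewrite mulrC -ltr_pdivlMr ?mulr_gt0//.
  have -> : e ^+ 2 / (4 * M) = e ^+ 2 / (8 * M) + e ^+ 2 / (8 * M).
    by field; rewrite gt_eqF.
  exact: ltrD.
exists l => h; apply/ler_addgt0Pr => e e0.
have e1 : 0 < e / (`|h| + 1) by rewrite divr_gt0// ltr_wpDl.
have e2 : 0 < e / (`|h| + 1) / 2 by rewrite divr_gt0.
near \oo => n.
have nd : harmonic n <= e / (`|h| + 1) / 2.
  by apply: ltW; near: n; exact: (near_infty_natSinv_lt (PosNum e2)).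
have : `|g n - l| <= e / (`|h| + 1) / 2.
  by rewrite distrC; near: n; apply: cvgr_dist_le.
set D := e / (`|h| + 1) / 2 in nd * => gl1.
have := normr_dot_le Hdot (g n - l) h; rewrite dotDl dotNl ler_norml => /andP[_ gh].
have hD : D * (`|h| + 1) = e / 2.
  by rewrite /D; field; rewrite gt_eqF// ltr_wpDl.
have := gP n h.
have : `|g n - l| * `|h| <= D * `|h| by rewrite ler_wpM2r.
lra.
Unshelve. all: by end_near. Qed.

End Completeness.

Section Riesz.
Context (R : realType) (H : completeNormedModType R) (dot : {dot H for idfun}).
Implicit Types u v w : H.
Hypothesis Hdot : norm_induced_by dot.

(** The functional J = L - |.|^2/2 is bounded above, and if J(g) is within e of
    its supremum, then J(g + h) - J(g) <= e reads L h <= e + <g, h> + |h|^2/2.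
    So near maximizers are approximate supergradients of L itself; an exact one
    represents L, since L is linear. *)
Lemma riesz_representation (L : {linear H -> R^o}) : continuous L ->
  exists g, forall h, L h = dot g h.
Proof.
move=> /linear_lipschitz[k k0 Lk].
pose J x := L x - 1 / 2 * `|x| ^+ 2.
have J_sup : has_sup (range J).
  split; first by exists (J 0), 0.
  exists (k ^+ 2 / 2) => _ [x _ <-]; rewrite /J.
  have := le_trans (ler_norm _) (Lk x).
  have : 0 <= (k - `|x|) ^+ 2 by exact: sqr_ge0.
  lra.
have [h|e e0|g Lg] := supergradient_of_approximations Hdot (phi := L) (M := 1) ltr01.
- by rewrite linearN subrr.
- have [_ [g _ <-] Jg] := sup_adherent e0 J_sup.
  exists g => h.
  have : J (g + h) <= sup (range J).
    by apply: sup_upper_bound => //; exists (g + h).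
  move: Jg; rewrite /J linearD !Hdot !dotE (dotC _ h g); lra.
have Lle h : L h <= dot g h.
  rewrite -subr_le0; apply: (@le0_of_le_quadratic _ _ (1 / 2 * `|h| ^+ 2)) => t _.
  have := Lg (t *: h).
  rewrite linearZ dotZr normrZ exprMn real_normK ?num_real//=.
  by rewrite -[_ *: _]/(t * L h); lra.
exists g => h; apply/eqP; rewrite eq_le Lle /=.
by have := Lle (- h); rewrite linearN dotNr lerN2.
Qed.

Lemma gradientP (F : H -> R^o) (x : H) : differentiable F x ->
  forall h, 'd F x h = dot (gradient dot F x) h.
Proof.
move=> /diff_continuous/riesz_representation[g Fg].
by rewrite (gradientE Hdot Fg).
Qed.

End Riesz.

(** * Convex functions and their tangent planes *)

Section ConvexFunctions.
Context (R : realType) (H : normedModType R).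

(** The bundled parameter of [convex_function] as a real number with bounds. *)
Lemma convex_functionP (F : H -> R^o) : convex_function setT F <->
  (forall t x y, 0 <= t <= 1 ->
    F (t *: x + (1 - t) *: y) <= t * F x + (1 - t) * F y).
Proof.
split=> [Fc t x y /andP[t0 t1]|Fc t x y _ _].
  exact: (Fc (Itv01 t0 t1) x y (in_setT _) (in_setT _)).
by apply: Fc; apply/andP; split.
Qed.

Lemma convex_midpoint (F : H -> R^o) (x h : H) :
  convex_function setT F -> 2 * F x <= F (x + h) + F (x - h).
Proof.
move=> /convex_functionP Fc.
have half : 0 <= (2^-1 : R) <= 1 by apply/andP; split; lra.
have := Fc _ (x + h) (x - h) half.
have -> : 2^-1 *: (x + h) + (1 - 2^-1) *: (x - h) = x.
  rewrite (_ : 1 - 2^-1 = 2^-1); last by field.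
  rewrite -scalerDr addrACA subrr addr0 scalerDr -scalerDl.
  by rewrite (_ : _ + _ = 1) ?scale1r//; field.
lra.
Qed.

(** On the segment from x to x + h convexity bounds the increment at t h by t
    times the full increment, while the differential approximates it up to
    o(t). *)
Lemma convex_above_tangent (F : H -> R^o) (x : H) :
  convex_function setT F -> differentiable F x ->
  forall h, F x + 'd F x h <= F (x + h).
Proof.
move=> /convex_functionP Fc Fx h; apply/ler_addgt0Pr => e e0.
have e1 : 0 < e / (`|h| + 1) by rewrite divr_gt0// ltr_wpDl.
have /diff_locally/eqaddoP/(_ _ e1) := Fx.
move=> /nbhs_ballP[d /= d0 dF].
(* Small enough for t h to lie in the ball of radius d; the summand 1 covers
   h = 0. *)
pose t := Num.min 1 (d / (`|h| + 1) / 2).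
have d1 : 0 < d / (`|h| + 1) / 2 by rewrite !divr_gt0// ltr_wpDl.
have t0 : 0 < t by rewrite lt_min ltr01 d1.
have t1 : t <= 1 by rewrite ge_min lexx.
have td : t <= d / (`|h| + 1) / 2 by rewrite ge_min lexx orbT.
have hd : d / (`|h| + 1) / 2 * (`|h| + 1) = d / 2.
  by field; rewrite gt_eqF// ltr_wpDl.
have he : e / (`|h| + 1) * (`|h| + 1) = e by rewrite divfK// gt_eqF// ltr_wpDl.
have h0 := normr_ge0 h.
have /dF : ball (0 : H) d (t *: h).
  by rewrite -ball_normE /= sub0r normrN normrZ gtr0_norm//; nra.
rewrite /= -[_ (t *: h)]/(F (t *: h + x) - (F x + 'd F x (t *: h))).
have -> : 'd F x (t *: h) = t * 'd F x h by rewrite linearZ.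
rewrite normrZ gtr0_norm// ler_norml => /andP[+ _].
have := Fc t (x + h) x; rewrite ltW// t1 => /(_ isT).
have -> : t *: (x + h) + (1 - t) *: x = t *: h + x.
  by rewrite scalerDr scalerBl scale1r addrC addrA subrK addrC.
nra.
Qed.

End ConvexFunctions.

(** * Functions between a tangent plane and a tangent paraboloid *)

Section TangentParaboloids.
Context (R : realType) (H : normedModType R) (dot : {dot H for idfun}).
Implicit Types u v w : H.
Hypothesis Hdot : norm_induced_by dot.

Lemma gradient_of_tangent_paraboloids (F : H -> R^o) (x g : H) (M : R) :
  (forall h, F x + dot g h <= F (x + h)) ->
  (forall h, F (x + h) <= F x + dot g h + M / 2 * `|h| ^+ 2) ->
  differentiable F x /\ gradient dot F x = g.
Proof.
move=> Fge Fle.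
have [|dF dFE] := differentiable_of_quadratic_remainder Hdot (F := F) (x := x)
    (u := g) (C := M / 2).
  move=> h; have := Fge h; have := Fle h => Fleh Fgeh.
  by rewrite ger0_norm; lra.
by split=> //; apply: (gradientE Hdot) => h; rewrite dFE.
Qed.

(** Midpoint convexity turns the upper bound at -t h into the lower bound
    F(x) + t <g, h> - M/2 t^2 |h|^2 at t h; convexity along the segment removes
    the second-order term as t tends to 0. *)
Lemma convex_above_supergradient (F : H -> R^o) (x g : H) (M : R) :
  convex_function setT F ->
  (forall h, F (x + h) <= F x + dot g h + M / 2 * `|h| ^+ 2) ->
  forall h, F x + dot g h <= F (x + h).
Proof.
move=> Fc Fle h; rewrite -subr_le0.
apply: (@le0_of_le_quadratic _ _ (M / 2 * `|h| ^+ 2)) => t /andP[t0 t1].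
have mid := convex_midpoint x (t *: h) Fc.
have := Fle (- (t *: h)).
rewrite dotNr dotZr normrN normrZ exprMn real_normK ?num_real// => FleN.
have := (convex_functionP F).1 Fc t (x + h) x; rewrite ltW// t1 => /(_ isT).
have -> : t *: (x + h) + (1 - t) *: x = x + t *: h.
  by rewrite scalerDr scalerBl scale1r addrC addrA subrK.
lra.
Qed.

(** Adding the condition at (x, y) and at (y, x) gives
    |G x - G y|^2 <= M <G x - G y, x - y>, and Cauchy-Schwarz concludes. *)
Lemma CW11_lipschitz (M : R) (E : set H) (f : H -> R) (G : H -> H) : 0 < M ->
  CW11 dot M E f G -> forall x y, E x -> E y -> `|G x - G y| <= M * `|x - y|.
Proof.
move=> M0 fG x y Ex Ey.
have := fG _ _ Ex Ey; have := fG _ _ Ey Ex.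
rewrite (distrC (G y)); set D := `|G x - G y| => fyx fxy.
have Dxy : D ^+ 2 <= M * dot (G x - G y) (x - y).
  rewrite -ler_pdivrMl//.
  have -> : M^-1 * D ^+ 2 = (2 * M)^-1 * D ^+ 2 + (2 * M)^-1 * D ^+ 2.
    by field; rewrite gt_eqF.
  by apply: le_trans (lerD fyx fxy) _; rewrite !dotE; lra.
have := le_trans (ler_norm _) (normr_dot_le Hdot (G x - G y) (x - y)).
rewrite -/D -(ler_pM2l M0) => /(le_trans Dxy).
have [->|D0] := eqVneq D 0; first by rewrite mulr_ge0// ltW.
by rewrite expr2 mulrCA ler_pM2l// lt_neqAle eq_sym D0 normr_ge0.
Qed.

(** At any point w, the paraboloid touching at x lies above the tangent plane at
    y.  The step h from x to w minimizes the gap between the two, and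
    this minimum is |g x - g y|^2/(2M) below the gap at x. *)
Lemma CW11_of_tangent_paraboloids (F : H -> R) (g : H -> H) (M : R) : 0 < M ->
  (forall x h, F x + dot (g x) h <= F (x + h)) ->
  (forall x h, F (x + h) <= F x + dot (g x) h + M / 2 * `|h| ^+ 2) ->
  CW11 dot M setT F g.
Proof.
move=> M0 Fge Fle x y _ _.
(* An abstract h keeps the rewriting of inner products from unfolding it. *)
have [h hE] : exists h, h = M^-1 *: (g y - g x) by eexists.
have hh : M / 2 * `|h| ^+ 2 = (2 * M)^-1 * `|g x - g y| ^+ 2.
  rewrite hE distrC normrZ exprMn real_normK ?num_real//.
  by field; rewrite gt_eqF.
have gh : dot (g y) h - dot (g x) h = 2 * ((2 * M)^-1 * `|g x - g y| ^+ 2).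
  rewrite -dotNl -dotDl hE dotZr -Hdot distrC.
  by field; rewrite gt_eqF.
have := Fle x h; have := Fge y (x - y + h).
have -> : y + (x - y + h) = x + h by rewrite addrA (addrC y) subrK.
rewrite hh dotDr.
lra.
Qed.

Lemma convex_C11_of_tangent_paraboloids (F : H -> R^o) (g : H -> H) (M : R) :
  0 < M ->
  (forall x h, F x + dot (g x) h <= F (x + h)) ->
  (forall x h, F (x + h) <= F x + dot (g x) h + M / 2 * `|h| ^+ 2) ->
  [/\ convex_function setT F, C11 dot F & CW11 dot M setT F (gradient dot F)].
Proof.
move=> M0 Fge Fle.
have gE : gradient dot F = g.
  by apply/funext => x; have [] := gradient_of_tangent_paraboloids (Fge x) (Fle x).
have CW := CW11_of_tangent_paraboloids M0 Fge Fle.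
split; last by rewrite gE.
  apply/convex_functionP => t x y /andP[t0 t1].
  (* A function supported by a plane at every point is convex: compare with the
     plane at z, whose slope terms at x and y cancel on averaging. *)
  have [z zE] : exists z, z = t *: x + (1 - t) *: y by eexists.
  have Fz w : F z + dot (g z) (w - z) <= F w.
    by have := Fge z (w - z); rewrite (addrC z) subrK.
  have z0 : t * dot (g z) (x - z) + (1 - t) * dot (g z) (y - z) = 0.
    have : dot (g z) z = t * dot (g z) x + (1 - t) * dot (g z) y.
      by rewrite {2}zE dotDr !dotZr.
    by rewrite !dotDr !dotNr; lra.
  have t2 : 0 <= 1 - t by rewrite subr_ge0.
  have := lerD (ler_wpM2l t0 (Fz x)) (ler_wpM2l t2 (Fz y)); rewrite !mulrDr -zE.
  lra.
split.
  by move=> x; have [] := gradient_of_tangent_paraboloids (Fge x) (Fle x).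
rewrite gE; apply: (@klipschitzW _ _ _ M).
  exact: (@globally_properfilter _ _ (0, 0)).
by move=> [x y] /= _; apply: (CW11_lipschitz M0 CW).
Qed.

End TangentParaboloids.

(** * Moreau envelopes *)

Section MoreauEnvelope.
Context (R : realType) (H : completeNormedModType R) (dot : {dot H for idfun}).
Implicit Types u v w : H.
Hypothesis Hdot : norm_induced_by dot.

(** The enveloped function is given by its epigraph S, or any set with the same
    lower boundary, so that it may take the value +oo while all computations
    stay in R. *)
Definition moreau_envelope (S : set (H * R)) (M : R) (x : H) : R :=
  inf [set p.2 + M / 2 * `|x - p.1| ^+ 2 | p in S].

Variables (S : set (H * R)) (M : R).
Hypothesis M0 : 0 < M.
Hypothesis S_neq0 : S !=set0.
Hypothesis S_convex : forall t p q, 0 <= t <= 1 -> S p -> S q ->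
  S (t *: p.1 + (1 - t) *: q.1, t * p.2 + (1 - t) * q.2).
Hypothesis S_lb : forall x,
  exists m, forall p, S p -> m <= p.2 + M / 2 * `|x - p.1| ^+ 2.

Local Notation env := (moreau_envelope S M).

Let env_has_inf x : has_inf [set p.2 + M / 2 * `|x - p.1| ^+ 2 | p in S].
Proof.
split; first by case: S_neq0 => p Sp; exists (p.2 + M / 2 * `|x - p.1| ^+ 2), p.
by have [m mS] := S_lb x; exists m => _ [p Sp <-]; apply: mS.
Qed.

Lemma moreau_envelope_le x p : S p -> env x <= p.2 + M / 2 * `|x - p.1| ^+ 2.
Proof. by move=> Sp; apply: ge_inf; [have [] := env_has_inf x|exists p]. Qed.

Lemma le_moreau_envelope x m :
  (forall p, S p -> m <= p.2 + M / 2 * `|x - p.1| ^+ 2) -> m <= env x.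
Proof.
move=> mS; apply: lb_le_inf; first by have [] := env_has_inf x.
by move=> _ [p Sp <-]; apply: mS.
Qed.

Lemma moreau_envelope_adherent x e : 0 < e ->
  exists2 p, S p & p.2 + M / 2 * `|x - p.1| ^+ 2 < env x + e.
Proof.
by move=> e0; have [_ [p Sp <-]] := inf_adherent e0 (env_has_inf x); exists p.
Qed.

Lemma moreau_envelope_convex : convex_function setT (env : H -> R^o).
Proof.
apply/convex_functionP => t x y t01; have /andP[t0 t1] := t01.
have t2 : 0 <= 1 - t by rewrite subr_ge0.
apply/ler_addgt0Pr => e e0.
have [p Sp px] := moreau_envelope_adherent x e0.
have [q Sq qy] := moreau_envelope_adherent y e0.
apply: le_trans (moreau_envelope_le _ (S_convex t01 Sp Sq)) _ => /=.
have -> : t *: x + (1 - t) *: y - (t *: p.1 + (1 - t) *: q.1) =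
    t *: (x - p.1) + (1 - t) *: (y - q.1).
  by rewrite !scalerBr opprD addrACA.
have sq_convex u v :
    `|t *: u + (1 - t) *: v| ^+ 2 <= t * `|u| ^+ 2 + (1 - t) * `|v| ^+ 2.
  have : 0 <= t * (1 - t) * `|u - v| ^+ 2 by rewrite !mulr_ge0// exprn_ge0.
  by rewrite !Hdot !dotE (dotC _ v u); lra.
have := ler_wpM2l (ltW (divr_gt0 M0 (ltr0n _ 2))) (sq_convex (x - p.1) (y - q.1)).
have := lerD (ler_wpM2l t0 (ltW px)) (ler_wpM2l t2 (ltW qy)).
rewrite !mulrDr; lra.
Qed.

(** If z nearly attains the infimum at x, keeping z as a candidate at x + h
    exhibits M (x - z) as an approximate supergradient of the envelope at x. *)
Lemma moreau_envelope_supergradient x :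
  exists g, forall h, env (x + h) <= env x + dot g h + M / 2 * `|h| ^+ 2.
Proof.
have [h|e e0|g gP] := supergradient_of_approximations Hdot
    (phi := fun h => env (x + h) - env x) M0.
- by have := convex_midpoint x h moreau_envelope_convex; lra.
- have [p Sp px] := moreau_envelope_adherent x e0.
  exists (M *: (x - p.1)) => h.
  have := moreau_envelope_le (x + h) Sp; move: px.
  by rewrite addrAC !Hdot !dotE !(dotC _ _ h) !(dotC _ p.1 x); lra.
- by exists g => h; have := gP h; lra.
Qed.

Lemma moreau_envelope_C11 :
  [/\ convex_function setT (env : H -> R^o), C11 dot (env : H -> R^o) &
      CW11 dot M setT env (gradient dot (env : H -> R^o))].
Proof.
have /choice[g gP] := moreau_envelope_supergradient.
apply: (convex_C11_of_tangent_paraboloids Hdot M0 _ gP) => x.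
exact: (convex_above_supergradient moreau_envelope_convex (gP x)).
Qed.

End MoreauEnvelope.

(** * Interpolation of the data on E *)

Section Interpolation.
Context (R : realType) (H : completeNormedModType R) (dot : {dot H for idfun}).
Implicit Types u v w : H.
Hypothesis Hdot : norm_induced_by dot.

Variables (M : R) (E : set H) (f : H -> R) (G : H -> H).
Hypotheses (M0 : 0 < M) (fG : CW11 dot M E f G).

(** The affine functions are those of slope G y taking the value
    f y - |G y|^2/(2M) at the transported point y - G y / M, rewritten around
    y. *)
Definition affine_sup_epigraph : set (H * R) := [set p | forall y, E y ->
  f y + (2 * M)^-1 * `|G y| ^+ 2 + dot (G y) (p.1 - y) <= p.2].

(** The condition (CW^{1,1}) in the transported variables: at the transported
    point of x no other affine function exceeds the one of x. *)
Lemma affine_sup_epigraph_shift x : E x ->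
  affine_sup_epigraph (x - M^-1 *: G x, f x - (2 * M)^-1 * `|G x| ^+ 2).
Proof.
move=> Ex y Ey /=; have := fG Ex Ey.
have iM : M^-1 = 2 * (2 * M)^-1 by field; rewrite gt_eqF.
by rewrite iM !Hdot !dotE (dotC _ (G y) (G x)); lra.
Qed.

(** Completing the square: M/2 |x - z|^2 - <G y, x - z> + |G y|^2/(2M) is the
    square M/2 |x - z - G y / M|^2. *)
Lemma affine_sup_epigraph_le p x y : affine_sup_epigraph p -> E y ->
  f y + dot (G y) (x - y) <= p.2 + M / 2 * `|x - p.1| ^+ 2.
Proof.
move=> Sp Ey; have := Sp _ Ey.
have : 0 <= M / 2 * `|x - p.1 - M^-1 *: G y| ^+ 2.
  by rewrite mulr_ge0 ?exprn_ge0// divr_ge0// ltW.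
have -> : M / 2 * `|x - p.1 - M^-1 *: G y| ^+ 2 = M / 2 * `|x - p.1| ^+ 2
    - dot (G y) (x - p.1) + (2 * M)^-1 * `|G y| ^+ 2.
  rewrite !Hdot; move: (x - p.1) => w; rewrite !dotE (dotC _ w).
  by field; rewrite gt_eqF.
by rewrite !dotE; lra.
Qed.

Lemma affine_sup_epigraph_convex t p q : 0 <= t <= 1 ->
  affine_sup_epigraph p -> affine_sup_epigraph q ->
  affine_sup_epigraph (t *: p.1 + (1 - t) *: q.1, t * p.2 + (1 - t) * q.2).
Proof.
move=> /andP[t0 t1] Sp Sq y Ey /=.
have t2 : 0 <= 1 - t by rewrite subr_ge0.
have := lerD (ler_wpM2l t0 (Sp y Ey)) (ler_wpM2l t2 (Sq y Ey)).
by rewrite !dotE; lra.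
Qed.

(** When E is empty there is no affine function to bound the envelope from
    below. *)
Lemma convex_C11_interpolation : E !=set0 ->
  exists F : H -> R^o,
    [/\ convex_function setT F, C11 dot F,
        (forall x : H, E x -> F x = f x),
        (forall x : H, E x -> gradient dot F x = G x) &
        CW11 dot M setT F (gradient dot F)].
Proof.
move=> [x0 Ex0]; pose F : H -> R^o := moreau_envelope affine_sup_epigraph M.
have S0 : affine_sup_epigraph !=set0 by eexists; apply: affine_sup_epigraph_shift Ex0.
have S_lb x : exists m, forall p, affine_sup_epigraph p ->
    m <= p.2 + M / 2 * `|x - p.1| ^+ 2.
  by eexists => p Sp; apply: affine_sup_epigraph_le Sp Ex0.
have [Fc FC FCW] := moreau_envelope_C11 Hdot M0 S0 affine_sup_epigraph_convex S_lb.
have Fge x h : E x -> f x + dot (G x) h <= F (x + h).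
  move=> Ex; apply: (le_moreau_envelope S0 S_lb) => p Sp.
  by have := affine_sup_epigraph_le (x + h) Sp Ex; rewrite [x + h - x]addrAC subrr add0r.
have Fle x h : E x -> F (x + h) <= f x + dot (G x) h + M / 2 * `|h| ^+ 2.
  move=> Ex; apply: le_trans (moreau_envelope_le S0 S_lb _ (affine_sup_epigraph_shift Ex)) _.
  rewrite /= opprD opprK addrA [x + h - x]addrAC subrr add0r le_eqVlt.
  apply/orP; left; apply/eqP; rewrite !Hdot !dotE (dotC _ h).
  by field; rewrite gt_eqF.
have Ff x : E x -> F x = f x.
  move=> Ex; apply/eqP; rewrite eq_le.
  have := Fge x 0 Ex; have := Fle x 0 Ex.
  rewrite addr0 normr0 expr0n mulr0 addr0 -(scale0r (0 : H)) dotZr mul0r addr0.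
  by move=> -> ->.
exists F; split=> // x Ex.
have [h|h|_ -> //] := gradient_of_tangent_paraboloids Hdot (F := F) (x := x)
  (g := G x) (M := M).
- by rewrite (Ff x Ex); apply: Fge.
- by rewrite (Ff x Ex); apply: Fle.
Qed.

End Interpolation.

(** * Necessity of the condition *)

Section Restriction.
Context (R : realType) (H : completeNormedModType R) (dot : {dot H for idfun}).
Implicit Types u v w : H.
Hypothesis Hdot : norm_induced_by dot.

(** The tangent plane at x + h, evaluated at x, bounds F(x + h) from above by
    F(x) + <grad F(x + h), h>, and replacing grad F(x + h) by grad F(x) costs
    K |h|^2, whence the constant 2K. *)
Lemma CW11_of_convex_C11 (F : H -> R^o) : convex_function setT F -> C11 dot F ->
  exists2 M, 0 < M & CW11 dot M setT F (gradient dot F).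
Proof.
move=> Fc [dF /pinfty_ex_gt0[K K0 gK]].
have Fge x h : F x + dot (gradient dot F x) h <= F (x + h).
  by rewrite -(gradientP Hdot)//; apply: convex_above_tangent.
exists (2 * K); first by rewrite mulr_gt0.
apply: (CW11_of_tangent_paraboloids Hdot _ Fge); first by rewrite mulr_gt0.
move=> x h; have := Fge (x + h) (- h); rewrite addrK dotNr.
have := gK (x + h, x) (conj I I); rewrite /= addrAC subrr add0r => gKh.
have := le_trans (ler_norm _)
  (normr_dot_le Hdot (gradient dot F (x + h) - gradient dot F x) h).
rewrite dotDl dotNl.
have : `|gradient dot F (x + h) - gradient dot F x| * `|h| <= K * `|h| * `|h|.
  by rewrite ler_wpM2r.
lra.
Qed.

End Restriction.

(** * The extension theorem *)

Theorem theorem1p3 (R : realType) (H : completeNormedModType R)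
    (dot : {dot H for idfun}) (Hdot : norm_induced_by dot)
    (E : set H) (f : H -> R) (G : H -> H) :
  ((exists F : H -> R^o,
      [/\ convex_function setT F, C11 dot F,
          (forall x : H, E x -> F x = f x) &
          (forall x : H, E x -> gradient dot F x = G x)])
   <-> (exists2 M : R, 0 < M & CW11 dot M E f G))
  /\
  (forall M : R, 0 < M -> CW11 dot M E f G ->
    exists F : H -> R^o,
      [/\ convex_function setT F, C11 dot F,
          (forall x : H, E x -> F x = f x),
          (forall x : H, E x -> gradient dot F x = G x) &
          CW11 dot M setT F (gradient dot F)]).
Proof.
(* A nonempty E is treated by the envelope; for E empty, F = 0 will do. *)
have extend (M : R) : 0 < M -> CW11 dot M E f G -> exists F : H -> R^o,
    [/\ convex_function setT F, C11 dot F,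
        (forall x : H, E x -> F x = f x),
        (forall x : H, E x -> gradient dot F x = G x) &
        CW11 dot M setT F (gradient dot F)].
  move=> M0 fG.
  have [E0|E0] := pselect (E !=set0).
    exact: (convex_C11_interpolation Hdot M0 fG E0).
  have dot0l v : dot 0 v = 0 by rewrite -(scale0r (0 : H)) dotZl mul0r.
  have [x h|x h|Fc FC FCW] := @convex_C11_of_tangent_paraboloids _ _ _ Hdot
      (cst 0) (cst 0) M M0.
  - by rewrite /= dot0l addr0.
  - by rewrite /= dot0l !add0r mulr_ge0 ?exprn_ge0// divr_ge0// ltW.
  by exists (cst 0); split=> // x Ex; case: E0; exists x.
split=> //; split=> [[F [Fc FC Ff FG]]|[M M0 fG]]; last first.
  by have [F [? ? ? ? _]] := extend M M0 fG; exists F.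
have [M M0 CW] := CW11_of_convex_C11 Hdot Fc FC.
exists M => // x y Ex Ey; rewrite -!Ff// -!FG//; exact: CW.
Qed.
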